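(* Let $(X,T)$ be a topological dynamical system. Then $(X,T)$ is a weakly mixing $E$-system if and only if $(K(X),T_K)$ is an $E$-system.
   Context: A topological dynamical system (t.d.s.) is a pair $(X,T)$ with $X$ a compact metric space and $T:X\to X$ a continuous surjective map; $\mathbb{Z}_+=\{0,1,2,\dots\}$. $K(X)$ is the space of non-empty closed subsets of $X$ with the Hausdorff metric (a compact metric space), and $T_K:K(X)\to K(X)$ is $T_K(C)=TC$; $(K(X),T_K)$ is again a t.d.s. $(X,T)$ is transitive if for all non-empty open $U,V\subset X$ the set $\{n\in\mathbb{Z}_+: T^{-n}V\cap U\ne\emptyset\}$ is infinite, and weakly mixing if $(X\times X,T\times T)$ is transitive. An $E$-system is a transitive t.d.s. $(X,T)$ admitting a $T$-invariant Borel probability measure $\mu$ with full support, $\mathrm{supp}(\mu)=X$. *)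

(* Defs.v *)
From HB Require Import structures.
From mathcomp Require Import all_boot all_order all_algebra.
From mathcomp Require Import all_classical all_reals all_analysis.

Set Implicit Arguments.
Unset Strict Implicit.
Unset Printing Implicit Defensive.

Import Order.TTheory GRing.Theory Num.Theory.
Import numFieldNormedType.Exports.

Local Open Scope classical_set_scope.
Local Open Scope ring_scope.

Section hausdorff_distance.
Context {R : realType} {X : metricType R}.
Implicit Types (x y : X) (A B : set X).

Definition dist_to_set x A : R := inf [set mdist x a | a in A].

Definition hausdorff_dist A B : R :=
  Num.max (sup [set dist_to_set a B | a in A])
          (sup [set dist_to_set b A | b in B]).

End hausdorff_distance.

(* The parameter [cX] does not occur in the fields: it makes the Hausdorff
   distance finite, so that the metric structure below is inferred from the
   type. *)
Record hyperspace (R : realType) (X : metricType R)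
    (cX : compact [set: X]) := Hyperspace {
  hset :> set X ;
  hset_neq0 : hset !=set0 ;
  hset_closed : closed hset }.

Section hyperspace_metric.
Context {R : realType} {X : metricType R} (cX : compact [set: X]).
Implicit Types (x y z : X) (A B C : hyperspace cX).

HB.instance Definition _ := gen_eqMixin (hyperspace cX).
HB.instance Definition _ := gen_choiceMixin (hyperspace cX).

Lemma hyperspace_eq A B : hset A = hset B -> A = B.
Proof.
case: A B => [A A0 Ac] [B B0 Bc] /= AB; move: A0 Ac; rewrite AB => A0 Ac.
by rewrite (Prop_irrelevance A0 B0) (Prop_irrelevance Ac Bc).
Qed.

Lemma compact_mdist_bounded : exists M : R, forall x y, mdist x y <= M.
Proof.
have [x0|noX] := pselect (inhabited X); last first.
  by exists 0 => x; exfalso; exact/noX/inhabits.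
case: x0 => x0.
suff [M xM] : exists M : R, forall x, mdist x0 x <= M.
  exists (M + M) => x y; apply: (le_trans (metric_triangle _ x0 _)).
  by rewrite lerD// metric_sym.
have /compact_near_coveringP cov := cX.
have /filter_ex[M xM] : \forall M \near (+oo : set_system R), [set: X] `<=` [set x | mdist x0 x <= M].
  apply: cov => x _.
  exists (ball x 1, [set M | mdist x0 x + 1 < M]) => /=.
    split; first exact: nbhsx_ballx.
    exact: nbhs_pinfty_gt (num_real _).
  move=> [y M]/= [xy xM]; rewrite (le_trans _ (ltW xM))//.
  apply: (le_trans (metric_triangle _ x _)).
  by move: xy; rewrite ballEmdist/= => xy; rewrite lerD2l ltW.
by exists M => x; exact: xM.
Qed.

Lemma has_inf_mdist x A : has_inf [set mdist x a | a in hset A].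
Proof.
split; first by have [a Aa] := hset_neq0 A; exists (mdist x a), a.
by exists 0 => _ [a _ <-]; exact: mdist_ge0.
Qed.

Lemma dist_to_set_le x A a : hset A a -> dist_to_set x A <= mdist x a.
Proof.
by move=> Aa; apply: (ge_inf (has_inf_mdist x A).2); exists a.
Qed.

Lemma dist_to_set_ge0 x A : 0 <= dist_to_set x A.
Proof.
apply: (lb_le_inf (has_inf_mdist x A).1) => _ [a _ <-]; exact: mdist_ge0.
Qed.

Lemma has_sup_dist_to_set A B :
  has_sup [set dist_to_set a (hset B) | a in hset A].
Proof.
split; first by have [a Aa] := hset_neq0 A; exists (dist_to_set a B), a.
have [M xM] := compact_mdist_bounded; exists M => _ [a _ <-].
have [b Bb] := hset_neq0 B; exact: le_trans (dist_to_set_le a Bb) (xM _ _).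
Qed.

Lemma hausdorff_dist_le A B (r : R) :
  (hausdorff_dist (hset A) (hset B) <= r) <->
  (forall a, hset A a -> dist_to_set a (hset B) <= r) /\
  (forall b, hset B b -> dist_to_set b (hset A) <= r).
Proof.
rewrite /hausdorff_dist ge_max; split => [/andP[AB BA]|[AB BA]].
  split=> [a Aa|b Bb].
    by apply: (le_trans _ AB); apply: (ub_le_sup (has_sup_dist_to_set A B).2);
      exists a.
  by apply: (le_trans _ BA); apply: (ub_le_sup (has_sup_dist_to_set B A).2);
    exists b.
apply/andP; split.
  by apply: ge_sup (has_sup_dist_to_set A B).1 _ => _ [a Aa <-]; exact: AB.
by apply: ge_sup (has_sup_dist_to_set B A).1 _ => _ [b Bb <-]; exact: BA.
Qed.

Lemma dist_to_set0 x A : dist_to_set x (hset A) <= 0 -> hset A x.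
Proof.
move=> xA; apply: hset_closed => U /nbhs_ballP[e /= e0 xeU].
have [_ [a Aa <-] axe] := inf_adherent e0 (has_inf_mdist x A).
exists a; split=> //; apply: xeU; rewrite ballEmdist/=.
by apply: (lt_le_trans axe); rewrite -/(dist_to_set x A) gerDr.
Qed.

Lemma dist_to_set_triangle x B C (r s : R) : dist_to_set x (hset B) <= r ->
  (forall b, hset B b -> dist_to_set b (hset C) <= s) ->
  dist_to_set x (hset C) <= r + s.
Proof.
move=> xB BC; apply/ler_addgt0Pr => e e0.
have e20 : 0 < e / 2 by rewrite divr_gt0.
have [_ [b Bb <-] xb] := inf_adherent e20 (has_inf_mdist x B).
have [_ [c Cc <-] bc] := inf_adherent e20 (has_inf_mdist b C).
apply: (le_trans (dist_to_set_le x Cc)).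
apply: (le_trans (metric_triangle _ b _)).
rewrite (splitr e) addrACA lerD// ltW//.
  by apply: (lt_le_trans xb); rewrite lerD2r.
by apply: (lt_le_trans bc); rewrite lerD2r; exact: BC.
Qed.

Let hdist A B : R := hausdorff_dist (hset A) (hset B).

Let hdistxx A : hdist A A = 0.
Proof.
have AA a : hset A a -> dist_to_set a (hset A) <= 0.
  by move=> Aa; rewrite (le_trans (dist_to_set_le a Aa))// mdistxx.
apply/le_anti/andP; split; first by apply/hausdorff_dist_le.
have [a Aa] := hset_neq0 A.
have [/(_ a Aa) + _] := (hausdorff_dist_le A A _).1 (lexx _).
exact/le_trans/dist_to_set_ge0.
Qed.

Let hdist_positivity A B : hdist A B = 0 -> A = B.
Proof.
move=> AB; have /hausdorff_dist_le[AB0 BA0] : hdist A B <= 0 by rewrite AB.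
apply/hyperspace_eq/seteqP; split=> x.
  by move/AB0/dist_to_set0.
by move/BA0/dist_to_set0.
Qed.

Let hdist_sym A B : hdist A B = hdist B A.
Proof. by rewrite /hdist /hausdorff_dist maxC. Qed.

Let hdist_triangle B A C : hdist A C <= hdist A B + hdist B C.
Proof.
have [AB BA] := (hausdorff_dist_le A B _).1 (lexx _).
have [BC CB] := (hausdorff_dist_le B C _).1 (lexx _).
apply/hausdorff_dist_le; split=> [a Aa|c Cc].
  exact: dist_to_set_triangle (AB _ Aa) BC.
by rewrite addrC; exact: dist_to_set_triangle (CB _ Cc) BA.
Qed.

HB.instance Definition _ := @isMetric.Build R (hyperspace cX)
  hdist hdistxx hdist_positivity hdist_sym hdist_triangle.

End hyperspace_metric.

Record tds (R : realType) (X : metricType R) (T : X -> X) : Prop := Tds {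
  tds_compact : compact [set: X] ;
  tds_continuous : continuous T ;
  tds_surjective : set_surj [set: X] [set: X] T }.

Section hyperspace_map.
Context {R : realType} {X : metricType R} {T : X -> X} (hT : tds T).
Local Notation KX := (hyperspace (tds_compact hT)).

Lemma hyperspace_map_neq0 (C : KX) : T @` hset C !=set0.
Proof. by have [x Cx] := hset_neq0 C; exists (T x), x. Qed.

Lemma hyperspace_map_closed (C : KX) : closed (T @` hset C).
Proof.
apply: compact_closed; first exact: metric_hausdorff.
apply: continuous_compact.
  by apply: continuous_subspaceT; exact: tds_continuous hT.
by apply: subclosed_compact (tds_compact hT) _ => //; exact: hset_closed.
Qed.

Definition hyperspace_map (C : KX) : KX :=
  Hyperspace _ (hyperspace_map_neq0 C) (@hyperspace_map_closed C).

End hyperspace_map.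

Arguments hyperspace_map {R X T} hT C.

Definition transitive_map (X : topologicalType) (T : X -> X) : Prop :=
  forall U V : set X, open U -> open V -> U !=set0 -> V !=set0 ->
    infinite_set [set n : nat | (iter n T @^-1` V) `&` U !=set0].

Definition weakly_mixing (X : topologicalType) (T : X -> X) : Prop :=
  transitive_map (fun p : X * X => (T p.1, T p.2)).

(* Measurable types are pointed, while [X] is not assumed to be: the point
   [x0] only serves to equip [X] with the required pointed structure. *)
Definition pointed_at (X : choiceType) (x0 : X) : Type := X.
HB.instance Definition _ (X : choiceType) (x0 : X) :=
  Choice.on (pointed_at x0).
HB.instance Definition _ (X : choiceType) (x0 : X) :=
  isPointed.Build (pointed_at x0) x0.

Definition borel (X : topologicalType) (x0 : X) :=
  g_sigma_algebraType (@open X : set (set (pointed_at x0))).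
HB.instance Definition _ (X : topologicalType) (x0 : X) :=
  Measurable.on (borel x0).

Section borel_measures.
Context {R : realType} {X : topologicalType} {x0 : X}.
Variable mu : probability (borel x0) R.

Definition invariant_measure (T : X -> X) : Prop :=
  forall A : set (borel x0), measurable A -> mu (T @^-1` A) = mu A.

Definition measure_support : set X :=
  [set x | forall U : set X, open_nbhs x U -> (0 < mu U)%E].

End borel_measures.

(* The existence of a point [x0] is no extra condition, since a space that
   carries a probability measure is nonempty. *)
Definition E_system (R : realType) (X : metricType R) (T : X -> X) : Prop :=
  [/\ tds T, transitive_map T &
      exists (x0 : X) (mu : probability (borel x0) R),
        invariant_measure mu T /\ measure_support mu = [set: X]].

(* Main.v *)
(* Both directions pass through visit times instead of product measures or
   measurable selections. If [mu] is invariant, [mu U > 0] and [S] does not have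
   density zero, then by dominated convergence some point visits [U] along a
   subset of [S] that again does not have density zero. Conversely, if every
   nonempty open set is visited by some point at a set of times that does not
   have density zero, then an invariant probability of full support exists:
   ultrafilter limits of visit frequencies are finitely additive and invariant,
   a Caratheodory construction from closed and open sets turns them into Borel
   measures, and a countable base allows to average these.

   From [X] to [K(X)], iterating the first fact yields points [x_1, .., x_p]
   visiting prescribed open sets simultaneously, so [{x_1, .., x_p}] visits a
   given open set of [K(X)]. From [K(X)] to [X], any point of a closed set that
   visits [{C | C `<=` U}] visits [U] at the same times. Transitivity of [K(X)]
   is equivalent to weak mixing of [X] by Furstenberg's intersection lemma and
   the surjectivity of [T]. *)
Require Import Defs.
From HB Require Import structures.
From mathcomp Require Import all_boot all_order all_algebra.
From mathcomp Require Import all_classical all_reals all_analysis.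
From mathcomp Require Import measurable_realfun.
From mathcomp Require Import lra.

Set Implicit Arguments.
Unset Strict Implicit.
Unset Printing Implicit Defensive.

Import Order.TTheory GRing.Theory Num.Theory.
Import numFieldNormedType.Exports.

Local Open Scope classical_set_scope.
Local Open Scope ring_scope.

(** * Sets of times of density zero *)

Section density.
Context {R : realType}.
Implicit Types S : set nat.

Definition frequency S (N : nat) : R := (\sum_(n < N) \1_S (n : nat)) / N%:R.

(** Frequencies are nonnegative, so convergence to 0 means upper density zero, and the negation
    means positive upper density. *)
Definition null_density S := frequency S @ \oo --> (0 : R).

Lemma frequency_ge0 S N : 0 <= frequency S N.
Proof. by rewrite divr_ge0// sumr_ge0// => n _; rewrite indicE. Qed.

Lemma frequency_le1 S N : frequency S N <= 1.
Proof.
case: N => [|N]; first by rewrite /frequency invr0 mulr0.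
rewrite ler_pdivrMr// mul1r -[N.+1 in leRHS]card_ord -sumr_const ler_sum//.
Qed.

Lemma null_densityS S S' : S `<=` S' -> null_density S' -> null_density S.
Proof.
move=> SS'; apply: squeeze_cvgr; last exact: cvg_cst.
near=> N; rewrite frequency_ge0/= ler_wpM2r ?invr_ge0// ler_sum// => n _.
rewrite !indicE ler_nat; case: (boolP (_ \in S)) => // /set_mem/SS'/mem_set ->.
Unshelve. all: by end_near. Qed.

Lemma not_null_densityT : ~ null_density [set: nat].
Proof.
move=> /cvgrPdist_lt/(_ 1 ltr01)[N _ /(_ N.+1 (leqnSn N))].
rewrite /frequency sub0r normrN; under eq_bigr do rewrite indicT.
by rewrite sumr_const card_ord divff ?pnatr_eq0// normr1 ltxx.
Qed.

End density.

(** * Visits to an open set under an invariant measure *)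

Section visits.
Context {R : realType} {X : topologicalType} (T : X -> X).
Hypothesis cT : continuous T.

Lemma continuous_iter n : continuous (iter n T).
Proof.
elim: n => [|n IH] x; first exact: cvg_id.
by apply: (@continuous_comp _ _ _ (iter n T) T); [exact: IH|exact: cT].
Qed.

Lemma open_iter_preimage n (U : set X) : open U -> open (iter n T @^-1` U).
Proof. by move=> oU; apply: open_comp => // x _; exact: continuous_iter. Qed.

Lemma open_borel_measurable (x0 : X) (U : set X) :
  open U -> measurable (U : set (borel x0)).
Proof. by move=> oU; exact: sub_sigma_algebra. Qed.

Context (x0 : X) (mu : probability (borel x0) R).
Hypothesis Tmu : invariant_measure mu T.

Lemma invariant_measure_iter n (U : set X) : open U ->
  mu (iter n T @^-1` U) = mu U.
Proof.
move=> oU; elim: n => // n <-.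
rewrite -(Tmu (open_borel_measurable (x0 := x0) (open_iter_preimage n oU))).
by congr (mu _); apply/seteqP; split => x /=; rewrite -iterSr.
Qed.

(* If almost every point visited [U] along [S] with zero density, dominated
   convergence would force the density of [S] times [mu U] to vanish. *)
Lemma exists_visits (S : set nat) (U : set X) : open U -> (0 < mu U)%E ->
  ~ null_density (R := R) S ->
  exists x, ~ null_density (R := R) (S `&` [set n | U (iter n T x)]).
Proof.
move=> oU U0 S0; apply: contrapT => /forallNP noX; apply: S0.
have {}noX x : null_density (R := R) (S `&` [set n | U (iter n T x)]).
  exact: contrapT.
pose f N (x : borel x0) : \bar R :=
  (frequency (S `&` [set n | U (iter n T x)]) N)%:E.
have fE N : f N = fun x : borel x0 => (\sum_(n < N)
    (N%:R^-1 * \1_S (n : nat))%:E * (\1_(iter n T @^-1` U) x)%:E)%E.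
  apply/funext => x; rewrite /f /frequency mulr_suml -sumEFin.
  apply: eq_bigr => n _; rewrite -EFinM; congr (_%:E).
  rewrite indicI /= mulrC mulrA; congr (_ * _).
have mU n : measurable (iter n T @^-1` U : set (borel x0)).
  by apply: open_borel_measurable; exact: open_iter_preimage.
have mf N : measurable_fun [set: borel x0] (f N).
  rewrite fE; apply: emeasurable_sum => n.
  apply: measurable_funeM; apply/measurable_EFinP.
  exact: measurable_indic.
(* By invariance each preimage has measure [mu U], so the integral of the visit frequency along [S]
   is the frequency of [S] times [mu U]. *)
have intf N : (\int[mu]_x f N x = (frequency S N)%:E * mu U)%E.
  rewrite fE ge0_integral_sum//; last first.
    move=> n; apply: measurable_funeM; apply/measurable_EFinP.
    exact: measurable_indic.
  rewrite (eq_bigr (fun n : 'I_N => ((N%:R^-1 * \1_S (n : nat))%:E * mu U)%E)).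
    rewrite -ge0_sume_distrl; last by move=> n _; rewrite lee_fin mulr_ge0.
    by rewrite sumEFin -mulr_sumr mulrC.
  move=> n _; rewrite ge0_integralZl_EFin//; last first.
    by apply/measurable_EFinP; exact: measurable_indic.
  by rewrite integral_indic// setIT; congr (_ * _)%E; exact: invariant_measure_iter.
have : (\int[mu]_x f N x @[N --> \oo] --> \int[mu]_x (cst 0 x))%E.
  apply: (@dominated_cvg _ _ _ mu setT measurableT f (cst 0%E) (cst 1%E)) => //.
  - by move=> x _; rewrite /f /cst; apply: cvg_EFin; [exact: nearW|exact: (noX x)].
  - exact: (finite_measure_integrable_cst mu 1 measurableT).
  - by move=> N x _; rewrite /f /= lee_fin ger0_norm ?frequency_ge0 ?frequency_le1.
rewrite integral0; under eq_fun do rewrite intf.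
have muU : mu U = (fine (mu U))%:E.
  by rewrite fineK// fin_num_measure//; exact: open_borel_measurable.
rewrite muU; under eq_fun do rewrite -EFinM.
move/fine_cvg => /= lim0.
have U0' : fine (mu U) != 0.
  by apply/eqP => U00; move: U0; rewrite muU U00 ltxx.
rewrite /null_density.
have -> : frequency S = (fun N => frequency S N * fine (mu U) * (fine (mu U))^-1).
  by apply/funext => N; rewrite mulfK.
have := cvgM lim0 (cvg_cst (fine (mu U))^-1).
by rewrite mul0r; exact.
Qed.

End visits.

(** * Borel measures from finitely additive set functions *)

Lemma borel_measurable_preimage (X : topologicalType) (x0 : X) (T : X -> X)
    (A : set (borel x0)) :
  continuous T -> measurable A -> measurable (T @^-1` A : set (borel x0)).
Proof.
move=> cT; apply: (@smallest_sub _ _ _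
  [set B : set (borel x0) | measurable (T @^-1` B : set (borel x0))]).
- split => [|B|F] /=.
  + by rewrite preimage_set0; exact: measurable0.
  + by move=> mB; rewrite setTD preimage_setC; exact: measurableC.
  + by move=> mF; rewrite preimage_bigcup; exact: bigcup_measurable.
- move=> U oU /=; apply: sub_sigma_algebra.
  by apply: open_comp => // x _; exact: cT.
Qed.

Section measure_of_finitely_additive.
Context {R : realType} {X : metricType R} (cX : compact [set: X]).
Variable m : set X -> R.
Hypotheses (m_ge0 : forall A, 0 <= m A) (mT : m [set: X] = 1)
  (mU : forall A B, A `&` B = set0 -> m (A `|` B) = m A + m B).

Let m0 : m set0 = 0.
Proof.
have := mU (set0I (set0 : set X)); rewrite setU0 => /eqP.
by rewrite -subr_eq subrr eq_sym => /eqP.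
Qed.

Let mS A B : A `<=` B -> m A <= m B.
Proof.
move=> AB; rewrite -(setDUK AB) mU ?lerDl//.
by rewrite setDE setICA setICr setI0.
Qed.

Let mU_le A B : m (A `|` B) <= m A + m B.
Proof.
have -> : A `|` B = A `|` (B `\` A).
  apply/seteqP; split=> x [Ax|]; [by left| |by left|by case=> ?; right].
  by move=> Bx; have [|nAx] := pselect (A x); [left|right].
rewrite mU; last by rewrite setDE setICA setICr setI0.
by rewrite lerD2l mS//; exact: subDsetl.
Qed.

(** [m] is only finitely additive. As in the Riesz representation theorem, it is regularised from
    inside by closed sets, then from outside by open sets, to obtain countable subadditivity. *)
Definition inner_content (U : set X) : \bar R :=
  ereal_sup [set (m K)%:E | K in [set K | closed K /\ K `<=` U]].

Definition outer_content (A : set X) : \bar R :=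
  ereal_inf [set inner_content U | U in [set U | open U /\ A `<=` U]].

Let inner_ge K U : closed K -> K `<=` U -> ((m K)%:E <= inner_content U)%E.
Proof. by move=> cK KU; apply: ereal_sup_ubound; exists K. Qed.

Let inner_le U x : (forall K, closed K -> K `<=` U -> ((m K)%:E <= x)%E) ->
  (inner_content U <= x)%E.
Proof. by move=> Kx; apply: ge_ereal_sup => _ [K [cK KU] <-]; exact: Kx. Qed.

Let inner_ge0 U : (0 <= inner_content U)%E.
Proof. by have := inner_ge (@closed0 X) (@sub0set _ U); rewrite m0. Qed.

Let innerS U V : U `<=` V -> (inner_content U <= inner_content V)%E.
Proof.
by move=> UV; apply: inner_le => K cK KU; apply: inner_ge => //; exact: subset_trans UV.
Qed.

Let inner_le1 U : (inner_content U <= 1)%E.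
Proof. by apply: inner_le => K _ _; rewrite lee_fin -mT mS. Qed.

(** The closed sets [K] minus [U] and [K] minus [V] are disjoint, hence separated by open [W1] and
    [W2]. Removing [W1], respectively [W2], from [K] leaves a closed part inside [U], respectively
    [V], and the two parts cover [K]. *)
Let innerU U V : open U -> open V ->
  (inner_content (U `|` V) <= inner_content U + inner_content V)%E.
Proof.
move=> oU oV; apply: inner_le => K cK KUV.
have cD W : open W -> closed (K `\` W).
  by move=> oW; rewrite setDE; apply: closedI => //; exact: open_closedC.
have [|W1 [W2 [oW1 oW2 KW1 KW2 W120]]] :=
  (normal_openP (R := R)).1 (@pseudometric_normal R X) _ _ (cD _ oU) (cD _ oV).
  by rewrite -subset0 => x [[Kx nU] [_ nV]]; have [] := KUV _ Kx.
apply: (@le_trans _ _ (m (K `\` W1) + m (K `\` W2))%:E).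
  rewrite lee_fin (le_trans _ (mU_le _ _))// mS// => x Kx.
  have [W1x|] := pselect (W1 x); last by left.
  right; split => // W2x; have : (W1 `&` W2) x by [].
  by rewrite W120.
rewrite EFinD leeD//; apply: inner_ge; try exact: cD.
- by move=> x [Kx nW1]; apply: contrapT => nU; apply/nW1/KW1.
- by move=> x [Kx nW2]; apply: contrapT => nV; apply/nW2/KW2.
Qed.

Let inner_bigsetU (U : (set X)^nat) n : (forall i, open (U i)) ->
  (inner_content (\big[setU/set0]_(i < n) U i) <=
   \sum_(i < n) inner_content (U i))%E.
Proof.
move=> oU; elim: n => [|n IH].
  by rewrite !big_ord0; apply: inner_le => K _; rewrite subset0 => ->; rewrite m0.
rewrite !big_ord_recr/=; apply: (le_trans (innerU _ (oU n))).
  by apply: big_rec => [|i V _ oV]; [exact: open0|exact: openU].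
by rewrite leeD2r.
Qed.

(** A closed [K] in the union is compact, so finitely many of the [U i] already cover it. *)
Let inner_sigma_subadditive (U : (set X)^nat) : (forall i, open (U i)) ->
  (inner_content (\bigcup_i U i) <= \sum_(i <oo) inner_content (U i))%E.
Proof.
move=> oU; apply: inner_le => K cK KU.
have /compact_near_coveringP cov : compact K by exact: subclosed_compact cX _.
have [n _ /(_ n (leqnn n)) Kn] :
    \forall n \near \oo, K `<=` \big[setU/set0]_(i < n) U i.
  apply: cov => x /KU[i _ Uix].
  exists (U i, [set n | (i < n)%N]) => /=.
    by split; [exact: open_nbhs_nbhs|exact: nbhs_infty_gt].
  move=> [y n]/= [Uiy lt_in].
  by rewrite -bigcup_mkord; exists i.
apply: (le_trans (inner_ge cK Kn)); apply: (le_trans (inner_bigsetU n oU)).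
rewrite -(big_mkord xpredT (fun i => inner_content (U i))).
by apply: nneseries_lim_ge.
Qed.

Let outer_le U A : open U -> A `<=` U -> (outer_content A <= inner_content U)%E.
Proof. by move=> oU AU; apply: ereal_inf_lbound; exists U. Qed.

Let outer_open U : open U -> outer_content U = inner_content U.
Proof.
move=> oU; apply/eqP; rewrite eq_le outer_le//=.
by apply: le_ereal_inf_tmp => _ [V [oV UV] <-]; exact: innerS.
Qed.

Let outer_ge0 A : (0 <= outer_content A)%E.
Proof. by apply: le_ereal_inf_tmp => _ [V _ <-]. Qed.

Let outerS A B : A `<=` B -> (outer_content A <= outer_content B)%E.
Proof.
move=> AB; apply: le_ereal_inf_tmp => _ [V [oV BV] <-].
by apply: outer_le => //; exact: subset_trans BV.
Qed.

Let outer0 : outer_content set0 = 0%E.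
Proof.
rewrite outer_open; last exact: open0.
apply/eqP; rewrite eq_le inner_ge0 andbT.
by apply: inner_le => K _; rewrite subset0 => ->; rewrite m0.
Qed.

Let outer_fin_num A : outer_content A \is a fin_num.
Proof.
rewrite ge0_fin_numE// (@le_lt_trans _ _ 1%E) ?ltry//.
by apply: le_trans (inner_le1 setT); apply: outer_le => //; exact: openT.
Qed.

Let outer_sigma_subadditive : sigma_subadditive outer_content.
Proof.
move=> A; apply/lee_addgt0Pr => e e0.
rewrite (le_trans _ (epsilon_trick _ _ (ltW e0)))//.
have /choice[U AU] : forall n, exists U, [/\ open U, A n `<=` U &
    (inner_content U <= outer_content (A n) + (e / (2 ^ n.+1)%:R)%:E)%E].
  move=> n; have en0 : 0 < e / (2 ^ n.+1)%:R :> R.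
    by rewrite divr_gt0// ltr0n expn_gt0.
  have [_ [U [oU AU] <-] /ltW Ue] := lb_ereal_inf_adherent en0 (outer_fin_num (A n)).
  by exists U.
apply: (@le_trans _ _ (inner_content (\bigcup_n U n))).
  apply: outer_le.
    by apply: bigcup_open => n _; have [] := AU n.
  by apply: subset_bigcup => n _; have [] := AU n.
apply: le_trans (inner_sigma_subadditive _) _.
  by move=> n; have [] := AU n.
by apply: lee_nneseries => // n _; have [] := AU n.
Qed.

HB.instance Definition _ := isOuterMeasure.Build R X outer_content
  outer0 outer_ge0 outerS outer_sigma_subadditive.

(** Inside an open [V], take a closed [K] in the part within [U], then a closed [L] in [V] minus
    [K], an open set containing [V] minus [U]. The sets [K] and [L] are disjoint, so [m K + m L] is
    the value of [m] on a closed subset of [V]. *)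
Let caratheodory_open U : open U -> outer_content.-caratheodory U.
Proof.
move=> oU; apply: le_caratheodory_measurable => A.
apply: le_ereal_inf_tmp => _ [V [oV AV] <-].
apply: (@le_trans _ _ (inner_content (V `&` U) + outer_content (V `&` ~` U))%E).
  rewrite leeD//; last by apply: outerS; exact: setSI.
  by apply: outer_le; [exact: openI|exact: setSI].
rewrite -leeBrDr//; apply: inner_le => K cK KVU.
rewrite leeBrDr// -leeBrDl//.
apply: (@le_trans _ _ (inner_content (V `\` K))).
  apply: outer_le; first by rewrite setDE; apply: openI => //; exact: closed_openC.
  by move=> x [Vx nUx]; split => // /KVU[].
apply: inner_le => L cL LVK; rewrite leeBrDl// -EFinD -mU; last first.
  by rewrite -subset0 => x [Kx /LVK[]].
by apply: inner_ge; [exact: closedU|move=> x [/KVU[]|/LVK[]]].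
Qed.

Context (x0 : X).

Let outer_borel : set (borel x0) -> \bar R := outer_content.

Let caratheodory_borel (A : set (borel x0)) :
  measurable A -> outer_content.-caratheodory A.
Proof.
apply: smallest_sub; last by move=> U; exact: caratheodory_open.
split.
- exact: caratheodory_measurable_set0.
- by move=> B mB; rewrite setTD; exact: caratheodory_measurable_setC.
- by move=> F mF; exact: caratheodory_measurable_bigcup.
Qed.

Let outer_borel_sigma_additive : semi_sigma_additive outer_borel.
Proof.
move=> F mF tF mUF.
apply: (@caratheodory_measure_sigma_additive R (borel x0) outer_content F) => //.
- by move=> n; exact: caratheodory_borel.
- exact: caratheodory_borel.
Qed.

HB.instance Definition _ := isMeasure.Build _ _ _ outer_borel
  outer0 outer_ge0 outer_borel_sigma_additive.

Let outer_borelT : outer_borel setT = 1%E.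
Proof.
rewrite /outer_borel outer_open; last exact: openT.
apply/eqP; rewrite eq_le inner_le1/= -mT.
by apply: inner_ge => //; exact: closedT.
Qed.

HB.instance Definition _ := Measure_isProbability.Build _ _ _ outer_borel
  outer_borelT.

Variable T : X -> X.
Hypotheses (cT : continuous T) (mTA : forall A, m (T @^-1` A) = m A).

Let outer_preimage A : (outer_content (T @^-1` A) <= outer_content A)%E.
Proof.
apply: le_ereal_inf_tmp => _ [U [oU AU] <-].
apply: (@le_trans _ _ (inner_content (T @^-1` U))).
  apply: outer_le; first by apply: open_comp => // x _; exact: cT.
  by move=> x /AU.
apply: inner_le => K cK KU.
have cTK : closed (T @` K).
  apply: compact_closed; first exact: metric_hausdorff.
  apply: continuous_compact; first exact: continuous_subspaceT.
  exact: subclosed_compact cX _.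
apply: (@le_trans _ _ (m (T @` K))%:E).
  by rewrite lee_fin -(mTA (T @` K)) mS// => x Kx; exists x.
by apply: inner_ge => // _ [x /KU ? <-].
Qed.

(** The measure may differ from [m] on individual sets. The comparison of a closed set with an open
    set around it survives the regularisation, as for weak limits of measures. *)
Lemma invariant_probability_of_finitely_additive :
  exists mu : probability (borel x0) R, invariant_measure mu T /\
    forall K U, closed K -> open U -> K `<=` U -> ((m K)%:E <= mu U)%E.
Proof.
exists outer_borel; split; last first.
  move=> K U cK oU KU; rewrite /= /outer_borel outer_open//.
  exact: inner_ge.
move=> A mA.
have mTA' : measurable (T @^-1` A : set (borel x0)).
  exact: borel_measurable_preimage.
apply/eqP; rewrite eq_le outer_preimage/=.
(* For a probability, the same inequality for the complement is the reverse inequality for [A]. *)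
have := outer_preimage (~` A).
have -> : outer_content (~` A) = (1 - outer_content A)%E.
  exact: (@probability_setC _ _ _ outer_borel A mA).
have -> : outer_content (T @^-1` (~` A)) = (1 - outer_content (T @^-1` A))%E.
  exact: (@probability_setC _ _ _ outer_borel _ mTA').
by rewrite leeD2lE// leeN2.
Qed.

End measure_of_finitely_additive.

(** * Ultrafilter limits of visit frequencies *)

Section limit_frequencies.
Context {R : realType}.

Lemma ultra_frequency_cvg (G : set_system nat) (S : set nat) : UltraFilter G ->
  exists l : R, frequency S @ G --> l.
Proof.
move=> GU.
have f01 : (frequency S @ G) (`[0, 1]%classic : set R).
  rewrite fmapE; apply: nearW => N /=; rewrite in_itv/=.
  by rewrite frequency_ge0 frequency_le1.
have [l [_ Gl]] := @segment_compact R 0 1 _ _ f01.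
exists l => A lA.
have [//|GA] := in_ultra_setVsetC (frequency S @^-1` A) GU.
by have [y [nAy Ay]] := Gl (~` A) A GA lA.
Qed.

Lemma frequency_shift_cvg0 (S : set nat) :
  frequency [set n | S n.+1] N - frequency S N @[N --> \oo] --> (0 : R).
Proof.
(* The sum telescopes to a difference of two indicator values, of modulus at most 1. The index shift
   makes the bound exactly the harmonic sequence and avoids division by 0. *)
rewrite -cvg_shiftS; apply/norm_cvg0P.
apply: (@squeeze_cvgr _ _ _ _ (cst 0) harmonic); last 2 first.
- exact: cvg_cst.
- exact: cvg_harmonic.
apply: nearW => N; rewrite normr_ge0/= /frequency -mulrBl -sumrB.
rewrite -(big_mkord xpredT (fun i => \1_[set n | S n.+1] i - \1_S i)).
rewrite (eq_bigr (fun i => \1_S i.+1 - \1_S i))//.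
rewrite telescope_sumr// normrM [X in _ * X]ger0_norm ?invr_ge0//.
rewrite -[leRHS]mul1r ler_wpM2r ?invr_ge0//.
by rewrite !indicE; do 2![case: (_ \in _)]; rewrite ?subrr ?sub0r ?subr0 ?normrN ?normr0 ?normr1.
Qed.

(** [m A] is the limit of the frequencies of visits to [A] along one ultrafilter. It refines
    convergence to infinity, which gives invariance, and contains the times where the frequency for
    [K] is at least some [e > 0], which gives [0 < m K]. *)
Lemma finitely_additive_of_visits (X : Type) (T : X -> X) (x : X) (K : set X) :
  ~ null_density (R := R) [set n | K (iter n T x)] ->
  exists m : set X -> R,
    [/\ forall A, 0 <= m A, m [set: X] = 1,
        forall A B, A `&` B = set0 -> m (A `|` B) = m A + m B,
        forall A, m (T @^-1` A) = m A & 0 < m K].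
Proof.
pose visits (A : set X) : set nat := [set n | A (iter n T x)].
move=> K0.
have [e e0 eK] : exists2 e : R, 0 < e &
    ~ \forall N \near \oo, frequency (visits K) N < e.
  apply: contrapT => noe; apply: K0; apply/cvgrPdist_lt => e e0.
  apply: contrapT => eK; apply: noe; exists e => //.
  apply: contra_not eK; apply: filterS => N.
  by rewrite sub0r normrN ger0_norm ?frequency_ge0.
pose F := within [set N | e <= frequency (visits K) N] \oo.
have FF : ProperFilter F.
  split; last exact: within_filter.
  rewrite /F /within/= => Fe; apply: eK; apply: filterS Fe => N /= eN.
  by rewrite ltNge; apply/negP.
have [G [GU FG]] := ultraFilterLemma FF.
have ooG : G --> \oo by move=> A ooA; apply: FG; exact: cvg_within ooA.
have /choice[m mP] : forall A, exists l : R, frequency (visits A) @ G --> l.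
  by move=> A; exact: ultra_frequency_cvg.
have mE A l : frequency (visits A) @ G --> l -> m A = l.
  by move=> Al; apply: norm_cvg_unique (mP A) Al.
exists m; split.
- move=> A; apply: (cvgr_to_ge (mP A)); apply: filterS filterT => N _.
  exact: frequency_ge0.
- apply: mE; apply: cvg_trans (near_eq_cvg _) (cvg_cst (1 : R)).
  (* The frequency at [N = 0] is 0 by the convention for division, so 1 is reached only from [N = 1]
     on. *)
  apply: ooG; exists 1%N => // -[//|N] _.
  rewrite /frequency (eq_bigr (fun=> 1)); last first.
    by move=> i _; rewrite indicE mem_set.
  by rewrite sumr_const card_ord divff ?pnatr_eq0.
- move=> A B AB; apply: mE.
  have -> : frequency (R := R) (visits (A `|` B)) =
      (fun N => frequency (visits A) N + frequency (visits B) N).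
    apply/funext => N; rewrite /frequency -mulrDl -big_split/=.
    congr (_ / _); apply: eq_bigr => n _; rewrite !indicE.
    rewrite (_ : visits (A `|` B) = visits A `|` visits B)// in_setU.
    case: (boolP (_ \in visits A)) => [/set_mem nA|_]; last by rewrite add0r.
    rewrite memNset ?addr0// => nB.
    by have : (A `&` B) (iter n T x) by []; rewrite AB.
  by apply: cvgD; exact: mP.
- move=> A; apply: mE.
  have -> : frequency (R := R) (visits (T @^-1` A)) = (fun N =>
      (frequency [set n | visits A n.+1] N - frequency (visits A) N) +
      frequency (visits A) N).
    by apply/funext => N; rewrite subrK.
  rewrite -[m A]add0r; apply: cvgD (mP A).
  by apply: cvg_trans (frequency_shift_cvg0 (visits A)); exact: cvg_app.
- apply: (lt_le_trans e0); apply: (cvgr_to_ge (mP K)).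
  by apply: FG; exact: withinT.
Qed.

End limit_frequencies.

(** * Invariant probabilities of full support *)

Section full_support.
Context {R : realType} {X : metricType R} (cX : compact [set: X]).

(** The enumeration maps onto a base but may also take values outside it, so openness is asserted
    only for the index found. *)
Lemma compact_metric_countable_base : exists B : (set X)^nat,
  forall (x : X) (U : set X), open U -> U x ->
    exists n, [/\ open (B n), B n x & B n `<=` U].
Proof.
have [[x0]|noX] := pselect (inhabited X); last first.
  by exists (fun=> set0) => x; exfalso; exact/noX/inhabits.
pose Y : pseudoPMetricType R := HB.pack (Metric.sort X) (isPointed.Build (Metric.sort X) x0).
have [B /pcard_surjP[f fB] [oB bB]] := @compact_second_countable R Y cX.
exists f => x U oU Ux.
have [V [BV Vx] VU] := bB x U (open_nbhs_nbhs (conj oU Ux)).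
have [n _ fn] := fB V BV.
by exists n; rewrite fn; split => //; exact: oB.
Qed.

Context (T : X -> X) (cT : continuous T) (x0 : X).
Hypothesis visits : forall U : set X, open U -> U !=set0 ->
  exists x, ~ null_density (R := R) [set n | U (iter n T x)].

(** By regularity some neighbourhood [V] has its closure inside [U]. Visits to the interior of [V]
    make [m] positive on that closure, and [mu U] is at least this value. *)
Lemma exists_invariant_probability_gt0 (U : set X) : open U -> U !=set0 ->
  exists mu : probability (borel x0) R, invariant_measure mu T /\ (0 < mu U)%E.
Proof.
move=> oU [x Ux].
have [V Vx VU] := @uniform_regular X x U (open_nbhs_nbhs (conj oU Ux)).
have [|y yV] := visits (@open_interior _ V).
  by exists x; exact: nbhs_singleton (nbhs_interior Vx).
have {}yV : ~ null_density (R := R) [set n | closure V (iter n T y)].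
  apply: contra_not yV; apply: null_densityS => n /=.
  by move=> /interior_subset; exact: subset_closure.
have [m [m0 mT mU mTA mV]] := finitely_additive_of_visits yV.
have [mu [Tmu muU]] :=
  invariant_probability_of_finitely_additive cX m0 mT mU x0 cT mTA.
exists mu; split => //; apply: lt_le_trans (muU _ _ _ oU VU).
  by rewrite lte_fin.
exact: closed_closure.
Qed.

Lemma exists_invariant_probability_full_support :
  exists mu : probability (borel x0) R,
    invariant_measure mu T /\ measure_support mu = [set: X].
Proof.
have [B HB] := compact_metric_countable_base.
have /choice[nu nuP] : forall n, exists mu : probability (borel x0) R,
    invariant_measure mu T /\ (open (B n) -> B n !=set0 -> (0 < mu (B n))%E).
  (* If [B n] is not open or is empty, any invariant probability will do; the case of the whole
     space provides one. *)
  move=> n; have [[oB B0]|nB] := pselect (open (B n) /\ B n !=set0).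
    have [mu [Tmu muB]] := exists_invariant_probability_gt0 oB B0.
    by exists mu.
  have [|mu [Tmu _]] := exists_invariant_probability_gt0 openT.
    by exists x0.
  by exists mu; split => // oB B0; exfalso; exact: nB.
(* The weights [1 / 2 ^ (n + 1)] are positive and sum to 1. *)
have w_ge0 n : 0 <= 1 / (2 ^ (n + 1))%:R :> R by [].
pose w n := NngNum (w_ge0 n).
pose mu : {measure set (borel x0) -> \bar R} := mseries (fun n => mscale (w n) (nu n)) 0.
have muE A : mu A = (\sum_(0 <= n <oo) (w n)%:num%:E * nu n A)%E by [].
have mu_ge n A : ((w n)%:num%:E * nu n A <= mu A)%E.
  rewrite muE (nneseriesD1 (n := n))//; last by move=> k _; rewrite mule_ge0.
  by rewrite leeDl// nneseries_ge0// => k _ _; rewrite mule_ge0.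
have muT : mu setT = 1%E.
  rewrite muE; transitivity (limn (eseries (fun n => ((w n)%:num)%:E))).
    by congr (limn _); apply/funext => n; apply: eq_bigr => k _; rewrite probability_setT mule1.
  by apply/cvg_lim => //; have := @cvg_geometric_eseries_half R 1 0; rewrite expr0 divr1.
(* The total mass is already 1, so normalisation leaves [mu] unchanged and supplies the probability
   structure; [nu 0] is only the default for a degenerate mass. *)
pose P : probability (borel x0) R := mnormalize mu (nu 0%N).
have PE A : P A = mu A.
  by rewrite /P/= /mnormalize muT onee_eq0/= invr1 mule1.
exists P; split.
  move=> A mA; rewrite !PE !muE; apply: eq_eseriesr => n _.
  by rewrite (nuP n).1.
apply/seteqP; split => // x _ U [oU Ux].
have [n [oB Bx BU]] := HB x U oU Ux.
rewrite PE; apply: lt_le_trans (mu_ge n U); rewrite mule_gt0//.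
  by rewrite lte_fin/= divr_gt0// ltr0n expn_gt0.
have nuB : (0 < nu n (B n))%E by apply: (nuP n).2 => //; exists x.
apply: (lt_le_trans nuB); apply: le_measure => //;
  by apply: mem_set; exact: open_borel_measurable.
Qed.

End full_support.

(** * Compactness and open sets of the hyperspace *)

Section hyperspace_topology.
Context {R : realType} {X : metricType R} (cX : compact [set: X]).
Local Notation KX := (hyperspace cX).
Implicit Types A B C : KX.

Lemma hyperspace_mdist_lt A B (e : R) : mdist A B < e ->
  forall a, hset A a -> exists2 b, hset B b & mdist a b < e.
Proof.
move=> ABe a Aa; have [AB _] := (hausdorff_dist_le A B _).1 (lexx _).
have e0 : 0 < e - mdist A B by rewrite subr_gt0.
have [_ [b Bb <-] ab] := inf_adherent e0 (has_inf_mdist a B).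
exists b => //; apply: (lt_le_trans ab).
by rewrite -lerBrDr opprB addrCA subrr addr0; exact: AB.
Qed.

Lemma hyperspace_mdist_le A B (e : R) :
  (forall a, hset A a -> exists2 b, hset B b & mdist a b <= e) ->
  (forall b, hset B b -> exists2 a, hset A a & mdist b a <= e) ->
  mdist A B <= e.
Proof.
move=> AB BA; apply/hausdorff_dist_le; split.
  by move=> a /AB[b Bb]; apply: le_trans; exact: dist_to_set_le.
by move=> b /BA[a Aa]; apply: le_trans; exact: dist_to_set_le.
Qed.

Lemma hyperspace_compact C : compact (hset C).
Proof. by apply: subclosed_compact cX _ => //; exact: hset_closed. Qed.

Section ultrafilter_limit.
Variables (F : set_system KX) (FU : UltraFilter F).

(** The Kuratowski limit along [F]: a point belongs to it when each ball around it is met by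
    [F]-almost every set. *)
Let limit : set X :=
  [set x | forall e : R, 0 < e -> F [set C | hset C `&` ball x e !=set0]].

(** Otherwise every point of [D] has a ball missed by [F]-almost every set, and compactness of [D]
    makes [F]-almost every set miss [D] itself. *)
Let limit_meets (D : set X) : closed D -> F [set C | hset C `&` D !=set0] ->
  limit `&` D !=set0.
Proof.
move=> cD FD; apply: contrapT => LD0.
have /compact_near_coveringP cov : compact D by exact: subclosed_compact cX _.
have /filterI/(_ FD)/filter_ex[C [DC [x [Cx Dx]]]] :
    \forall C \near F, D `<=` [set x | ~ hset C x].
  apply: cov => x Dx.
  have /existsNP[e /not_implyP[e0 nFe]] : ~ limit x.
    by move=> Lx; apply: LD0; exists x.
  exists (ball x e, ~` [set C | hset C `&` ball x e !=set0]) => /=.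
    split; first exact: nbhsx_ballx.
    by have [] := in_ultra_setVsetC [set C | hset C `&` ball x e !=set0] FU.
  by move=> [y C] /= [xy nC] Cy; apply: nC; exists y.
exact: DC Dx Cx.
Qed.

Let limit_neq0 : limit !=set0.
Proof.
have [|x [Lx _]] := @limit_meets setT closedT; last by exists x.
by apply: filterS filterT => C _; have [x Cx] := hset_neq0 C; exists x.
Qed.

Let limit_closed : closed limit.
Proof.
move=> x Lx e e0; have e20 : 0 < e / 2 by rewrite divr_gt0.
have [y [Ly xy]] := Lx _ (nbhsx_ballx x _ e20).
apply: filterS (Ly _ e20) => C [c [Cc yc]]; exists c; split => //.
by rewrite [e]splitr; exact: ball_triangle yc.
Qed.

Lemma hyperspace_ultra_cvg : exists L : KX, F --> L.
Proof.
exists (Hyperspace cX limit_neq0 limit_closed) => N /nbhs_ballP[e /= e0 eN].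
apply: filterS eN _; have e20 : 0 < e / 2 by rewrite divr_gt0.
have e40 : 0 < e / 2 / 2 by rewrite divr_gt0.
have /compact_near_coveringP cov : compact limit by exact: subclosed_compact cX _.
have LC : \forall C \near F,
    limit `<=` [set x | exists2 c, hset C c & mdist x c <= e / 2].
  apply: cov => x Lx.
  exists (ball x (e / 2 / 2), [set C | hset C `&` ball x (e / 2 / 2) !=set0]) => /=.
    by split; [exact: nbhsx_ballx|exact: Lx].
  move=> [y C] /= [xy [c [Cc xc]]]; exists c => //.
  have := ball_triangle (ball_sym xy) xc.
  by rewrite -splitr ballEmdist => /ltW.
have CL : \forall C \near F,
    forall c, hset C c -> exists2 x, limit x & mdist c x <= e / 2.
  (* If [F]-almost every set met the complement [D] of this neighbourhood of the limit, then so
     would the limit. Hence [F]-almost every set lies in the neighbourhood. *)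
  pose D := ~` \bigcup_(x in limit) (ball x (e / 2))°.
  have cD : closed D.
    by apply: open_closedC; apply: bigcup_open => x _; exact: open_interior.
  have [FD|] := in_ultra_setVsetC [set C | hset C `&` D !=set0] FU.
    have [x [Lx []]] := limit_meets cD FD.
    by exists x => //; exact: nbhs_singleton (nbhs_interior (nbhsx_ballx _ _ e20)).
  apply: filterS => C /= nCD c Cc; apply: contrapT => nL; apply: nCD.
  exists c; split => // -[x Lx /interior_subset].
  rewrite ballEmdist => /ltW; rewrite metric_sym => xc.
  by apply: nL; exists x.
apply: filterS2 LC CL => C LC CL /=; rewrite ballEmdist/=.
apply: (@le_lt_trans _ _ (e / 2)); last by rewrite ltr_pdivrMr// ltr_pMr// ltr1n.
exact: hyperspace_mdist_le.
Qed.

End ultrafilter_limit.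

Lemma compact_hyperspace : compact [set: KX].
Proof.
rewrite compact_ultra => F FU _.
by have [L FL] := hyperspace_ultra_cvg FU; exists L.
Qed.

(** Compactness of [C] turns the radii available at its points into a single one. *)
Lemma hyperspace_sub_ball (C : KX) (U : set X) : open U -> hset C `<=` U ->
  exists2 e : R, 0 < e & forall x y, hset C x -> mdist x y < e -> U y.
Proof.
move=> oU CU.
have /compact_near_coveringP cov := @hyperspace_compact C.
have : \forall e \near (0 : R)^'+,
    hset C `<=` [set x | forall y, mdist x y < e -> U y].
  apply: cov => x /CU Ux.
  have [r /= r0 rU] := (nbhs_ballP _ _).1 (open_nbhs_nbhs (conj oU Ux)).
  have r20 : 0 < r / 2 by rewrite divr_gt0.
  exists (ball x (r / 2), [set e | e < r / 2]) => /=.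
    by split; [exact: nbhsx_ballx|exact: nbhs_right_lt].
  move=> [z e] /= [xz er] y zy; apply: rU; rewrite [r]splitr.
  by apply: ball_triangle xz _; rewrite ballEmdist/=; exact: lt_trans er.
move=> /(filterI (nbhs_right_gt 0))/filter_ex[e [/= e0 eU]].
by exists e => // x y Cx; exact: eU.
Qed.

Lemma open_hyperspace_sub (U : set X) : open U -> open [set C : KX | hset C `<=` U].
Proof.
move=> oU; rewrite openE => C /= CU; apply/nbhs_ballP.
have [e e0 eU] := hyperspace_sub_ball oU CU.
exists e => //= D; rewrite ballEmdist/= metric_sym => CD d Dd.
have [c Cc dc] := hyperspace_mdist_lt CD Dd.
by apply: eU Cc _; rewrite metric_sym.
Qed.

Lemma open_hyperspace_meets (U : set X) :
  open U -> open [set C : KX | hset C `&` U !=set0].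
Proof.
move=> oU; rewrite openE => C /= [x [Cx Ux]].
have [e /= e0 eU] := (nbhs_ballP _ _).1 (open_nbhs_nbhs (conj oU Ux)).
apply/nbhs_ballP; exists e => //= D; rewrite ballEmdist/= => CD.
have [d Dd xd] := hyperspace_mdist_lt CD Cx.
by exists d; split => //; apply: eU; rewrite ballEmdist.
Qed.

(** The basic set of the Vietoris topology given by the balls of radius [e] around the entries of
    [s]: [D] lies in their union and meets each of them. *)
Definition in_box (s : seq X) (e : R) (D : set X) : Prop :=
  (forall d, D d -> exists2 x, x \in s & mdist x d < e) /\
  (forall x, x \in s -> exists2 d, D d & mdist x d < e).

Lemma hyperspace_box (U : set KX) : open U -> U !=set0 ->
  exists s : seq X, exists2 e : R, 0 < e /\ (exists x, x \in s) &
    forall C, in_box s e (hset C) -> U C.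
Proof.
move=> oU [C UC]; have [x0 Cx0] := hset_neq0 C.
have [r /= r0 rU] := (nbhs_ballP _ _).1 (open_nbhs_nbhs (conj oU UC)).
(* For a finite [r / 3]-net [s] of [C] inside [C], a set in the box is within [2 r / 3] of [C],
   strictly less than [r]. *)
have e0 : 0 < r / 3 by rewrite divr_gt0.
pose Y : pseudoPMetricType R := HB.pack (Metric.sort X) (isPointed.Build (Metric.sort X) x0).
have : @cover_compact Y (hset C) by rewrite -compact_cover; exact: hyperspace_compact.
move=> /(_ _ (hset C) (fun x => (ball x (r / 3))°)).
case=> [x _|x Cx|s sC Cs].
- exact: open_interior.
- by exists x => //; exact: nbhs_singleton (nbhs_interior (nbhsx_ballx _ _ e0)).
have {}Cs c : hset C c -> exists2 x, x \in finmap.enum_fset s & mdist x c < r / 3.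
  by move=> /Cs[x /= xs /interior_subset]; rewrite ballEmdist; exists x.
exists (finmap.enum_fset s), (r / 3); first by split => //; have [x] := Cs _ Cx0; exists x.
move=> D [Ds sD]; apply: rU; rewrite ballEmdist/=.
apply: (@le_lt_trans _ _ (r / 3 + r / 3)); last by lra.
  apply: hyperspace_mdist_le.
    move=> c /Cs[x xs xc]; have [d Dd xd] := sD x xs.
    exists d => //; apply: le_trans (metric_triangle _ x _) _.
    by rewrite lerD// ltW// metric_sym.
  move=> d /Ds[x xs xd]; exists x; first by have := sC x xs; rewrite inE.
  by rewrite metric_sym (le_trans (ltW xd))// lerDl ltW.
Qed.

End hyperspace_topology.

(** * The induced map on the hyperspace *)

Section hyperspace_tds.
Context {R : realType} {X : metricType R} {T : X -> X} (hT : tds T).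
Local Notation KX := (hyperspace (tds_compact hT)).

Lemma tds_uniformly_continuous (e : R) : 0 < e ->
  exists2 d : R, 0 < d & forall x y, mdist x y < d -> mdist (T x) (T y) < e.
Proof.
move=> e0; have e20 : 0 < e / 2 by rewrite divr_gt0.
have /compact_near_coveringP cov := tds_compact hT.
have : \forall d \near (0 : R)^'+,
    [set: X] `<=` [set x | forall y, mdist x y < d -> mdist (T x) (T y) < e].
  apply: cov => x _.
  have [r /= r0 rT] := (nbhs_ballP _ _).1 (tds_continuous hT (nbhsx_ballx (T x) _ e20)).
  have r20 : 0 < r / 2 by rewrite divr_gt0.
  exists (ball x (r / 2), [set d | d < r / 2]) => /=.
    by split; [exact: nbhsx_ballx|exact: nbhs_right_lt].
  move=> [z d] /= [xz dr] y zy.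
  have Tz : ball (T x) (e / 2) (T z).
    by apply: rT; apply: le_ball xz; rewrite ler_pdivrMr// ler_pMr// ler1n.
  have Ty : ball (T x) (e / 2) (T y).
    apply: rT; rewrite [r]splitr.
    by apply: ball_triangle xz _; rewrite ballEmdist/=; exact: lt_trans dr.
  by have := ball_triangle (ball_sym Tz) Ty; rewrite -splitr ballEmdist.
move=> /(filterI (nbhs_right_gt 0))/filter_ex[d [/= d0 dT]].
by exists d => // x y; exact: dT.
Qed.

Lemma hyperspace_map_continuous : continuous (hyperspace_map hT).
Proof.
move=> C N /nbhs_ballP[e /= e0 eN]; apply/nbhs_ballP.
have e20 : 0 < e / 2 by rewrite divr_gt0.
have [d d0 dT] := tds_uniformly_continuous e20.
exists d => //= D; rewrite ballEmdist/= => CD; apply: eN; rewrite ballEmdist/=.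
apply: (@le_lt_trans _ _ (e / 2)); last by rewrite ltr_pdivrMr// ltr_pMr// ltr1n.
apply: hyperspace_mdist_le => _ [x xC <-].
  have [y Dy xy] := hyperspace_mdist_lt CD xC.
  by exists (T y); [exists y|exact/ltW/dT].
rewrite metric_sym in CD; have [y Dy xy] := hyperspace_mdist_lt CD xC.
by exists (T y); [exists y|exact/ltW/dT].
Qed.

Lemma hyperspace_map_surj : set_surj [set: KX] [set: KX] (hyperspace_map hT).
Proof.
move=> C _.
have neq0 : T @^-1` hset C !=set0.
  have [c Cc] := hset_neq0 C.
  by have [x _ Tx] := tds_surjective hT (I : [set: X]%classic c); exists x; rewrite /= Tx.
have cl : closed (T @^-1` hset C).
  apply: closed_comp; last exact: hset_closed.
  by move=> x _; exact: (tds_continuous hT).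
exists (Hyperspace (tds_compact hT) neq0 cl) => //; apply: hyperspace_eq => /=.
by apply: image_preimage; apply/seteqP; split => // x _; exact: (tds_surjective hT).
Qed.

Lemma hyperspace_map_tds : tds (hyperspace_map hT).
Proof.
split; first exact: compact_hyperspace.
- exact: hyperspace_map_continuous.
- exact: hyperspace_map_surj.
Qed.

Lemma hset_iter_hyperspace_map n (C : KX) :
  hset (iter n (hyperspace_map hT) C) = iter n T @` hset C.
Proof.
elim: n => [|n IH]; first by rewrite image_id.
by rewrite /= IH image_comp.
Qed.

Lemma finite_hyperspace (D : set X) : finite_set D -> D !=set0 ->
  exists C : KX, hset C = D.
Proof.
move=> fD D0.
have cD : closed D.
  by apply: compact_closed; [exact: metric_hausdorff|exact: finite_compact].
by exists (Hyperspace (tds_compact hT) D0 cD).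
Qed.

End hyperspace_tds.

(** * Weak mixing and common return times *)

Section weak_mixing.
Context {X : topologicalType} (T : X -> X).

Lemma iter_pair n (p : X * X) :
  iter n (fun p => (T p.1, T p.2)) p = (iter n T p.1, iter n T p.2).
Proof. by elim: n p => [[]|n IH p] //=; rewrite IH. Qed.

Lemma weakly_mixing_transitive2 (U1 U2 V1 V2 : set X) : weakly_mixing T ->
  open U1 -> open U2 -> open V1 -> open V2 ->
  U1 !=set0 -> U2 !=set0 -> V1 !=set0 -> V2 !=set0 ->
  infinite_set [set n | (iter n T @^-1` V1) `&` U1 !=set0 /\
                        (iter n T @^-1` V2) `&` U2 !=set0].
Proof.
move=> wT oU1 oU2 oV1 oV2 [u1 Uu1] [u2 Uu2] [v1 Vv1] [v2 Vv2].
have oX (A B : set X) : open A -> open B -> open (A `*` B).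
  by move=> oA oB; rewrite openE => -[a b] [/= Aa Bb]; exists (A, B) => //=; split; exact: open_nbhs_nbhs.
have := wT _ _ (oX _ _ oU1 oU2) (oX _ _ oV1 oV2)
  (ex_intro _ (u1, u2) (conj Uu1 Uu2)) (ex_intro _ (v1, v2) (conj Vv1 Vv2)).
apply: sub_infinite_set => n [[x y]] [/=]; rewrite iter_pair => -[/= Vx Vy] [/= Ux Uy].
by split; [exists x|exists y].
Qed.

Lemma weakly_mixing_transitive : weakly_mixing T -> transitive_map T.
Proof.
move=> wT U V oU oV U0 V0.
have := weakly_mixing_transitive2 wT oU oU oV oV U0 U0 V0 V0.
by apply: sub_infinite_set => n [].
Qed.

(* Furstenberg's intersection lemma: a return time from [A `&` T^-n U] to
   [B `&` T^-n V] is a return time both from [A] to [B] and from [U] to [V]. *)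
Lemma weakly_mixing_return_times (I : eqType) (l : seq I) (U V : I -> set X) :
  continuous T -> weakly_mixing T -> [set: X] !=set0 ->
  (forall i, open (U i)) -> (forall i, open (V i)) ->
  (forall i, U i !=set0) -> (forall i, V i !=set0) ->
  exists A B : set X, [/\ open A, open B, A !=set0, B !=set0 &
    forall n, (iter n T @^-1` B) `&` A !=set0 ->
      forall i, i \in l -> (iter n T @^-1` V i) `&` U i !=set0].
Proof.
move=> cT wT X0 oU oV U0 V0.
elim: l => [|i l [A [B [oA oB A0 B0 AB]]]].
  by exists setT, setT; split => //; exact: openT.
have /infinite_setN0[n [[a [Ua Aa]] [b [Vb Bb]]]] :=
  weakly_mixing_transitive2 wT oA oB (oU i) (oV i) A0 B0 (U0 i) (V0 i).
exists (A `&` iter n T @^-1` U i), (B `&` iter n T @^-1` V i); split.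
- by apply: openI => //; exact: open_iter_preimage.
- by apply: openI => //; exact: open_iter_preimage.
- by exists a.
- by exists b.
move=> k [x [/= [Bx Vx] [Ax Ux]]] j; rewrite inE => /predU1P[->|jl].
  (* Iterates commute: [x] reaches [U i] after [n] steps, and [k] further steps lead to [V i]. *)
  by exists (iter n T x); split => //=; rewrite -iterD addnC iterD.
by apply: AB jl; exists x.
Qed.

End weak_mixing.

(** * Transfer between the space and its hyperspace *)

Section hyperspace_dynamics.
Context {R : realType} {X : metricType R} {T : X -> X} (hT : tds T).
Local Notation KX := (hyperspace (tds_compact hT)).
Local Notation TK := (hyperspace_map hT).

(** Centres may repeat, so one list of pairs can serve a box around the first components and, after
    iteration, one around the second components. *)
Lemma finite_image_in_box (I : eqType) (l : seq I) (f : I -> X) (c : I -> X)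
    (s : seq X) (e : R) :
  (forall i, i \in l -> c i \in s /\ ball (c i) e (f i)) ->
  (forall x, x \in s -> exists2 i, i \in l & c i = x) ->
  in_box s e (f @` [set` l]).
Proof.
move=> lf sl; split => [_ [i /= il <-]|x /sl[i il <-]].
  by have [cs] := lf i il; rewrite ballEmdist; exists (c i).
by have [_] := lf i il; rewrite ballEmdist; exists (f i) => //; exists i.
Qed.

Lemma transitive_hyperspace_map : weakly_mixing T -> transitive_map TK.
Proof.
move=> wT U V oU oV U0 V0.
have [s [e [e0 [x0 x0s]] sU]] := hyperspace_box oU U0.
have [t [f [f0 [y0 y0t]] tV]] := hyperspace_box oV V0.
(* With all pairs of centres, each centre of either box occurs, whatever the lengths of [s] and [t].
   One time [n] then works for all pairs, and one point per pair forms the finite set sought. *)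
pose l : seq (X * X) := [seq (x, y) | x <- s, y <- t].
have lP p : p \in l -> p.1 \in s /\ p.2 \in t.
  by move=> /allpairsP[[x y] [xs yt ->]].
have ball0 (x : X) (r : R) : 0 < r -> (ball x r)° !=set0.
  by move=> r0; exists x; exact: nbhs_singleton (nbhs_interior (nbhsx_ballx _ _ r0)).
have [A [B [oA oB A0 B0 AB]]] := weakly_mixing_return_times l
  (tds_continuous hT) wT (ex_intro _ x0 I)
  (fun p : X * X => open_interior (ball p.1 e))
  (fun p : X * X => open_interior (ball p.2 f))
  (fun p => ball0 _ _ e0) (fun p => ball0 _ _ f0).
apply: sub_infinite_set (weakly_mixing_transitive wT oA oB A0 B0) => n nAB.
have /choice[g gP] : forall p, exists x, p \in l ->
    ball p.1 e x /\ ball p.2 f (iter n T x).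
  move=> p; have [pl|npl] := boolP (p \in l); last by exists x0.
  by have [x [/interior_subset fx /interior_subset ex]] := AB n nAB p pl; exists x.
have [|C CE] := finite_hyperspace hT (finite_image g (finite_seq l)).
  by exists (g (x0, y0)), (x0, y0) => //=; exact: allpairs_f.
exists C; split => /=; last first.
  apply: sU; rewrite CE; apply: (finite_image_in_box (c := fst)) => [p pl|x xs].
    by have [? _] := lP p pl; have [? _] := gP p pl.
  by exists (x, y0) => //; exact: allpairs_f.
apply: tV; rewrite hset_iter_hyperspace_map CE image_comp.
apply: (finite_image_in_box (c := snd)) => [p pl|y yt].
  by have [_ ?] := lP p pl; have [_ ?] := gP p pl.
by exists (x0, y) => //; exact: allpairs_f.
Qed.

(* With [E = U1 `&` T^-a U2], a common return time from [E] to [V1] and to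
   [T^-a V2] is one from [U1] to [V1] and from [U2] to [V2]. *)
Lemma weakly_mixing_of_hyperspace : transitive_map TK -> weakly_mixing T.
Proof.
move=> tK.
(* Transitivity of the hyperspace from the subsets of [U] to the sets meeting both [V1] and [V2]
   gives simultaneous visits from one source. *)
have ret (U V1 V2 : set X) : open U -> open V1 -> open V2 ->
    U !=set0 -> V1 !=set0 -> V2 !=set0 ->
    infinite_set [set n | (iter n T @^-1` V1) `&` U !=set0 /\
                          (iter n T @^-1` V2) `&` U !=set0].
  move=> oU oV1 oV2 [u Uu] [v1 V1v1] [v2 V2v2].
  have KU0 : [set C : KX | hset C `<=` U] !=set0.
    have [|C CE] := finite_hyperspace hT (finite_set1 u); first by exists u.
    by exists C; rewrite /= CE => _ ->.
  have KV0 : [set C : KX | hset C `&` V1 !=set0] `&`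
      [set C : KX | hset C `&` V2 !=set0] !=set0.
    have [|C CE] := finite_hyperspace hT (finite_set2 v1 v2); first by exists v1; left.
    exists C; split; rewrite /= CE.
      by exists v1; split => //; left.
    by exists v2; split => //; right.
  have := tK _ _ (open_hyperspace_sub (cX := tds_compact hT) oU)
    (openI (open_hyperspace_meets (cX := tds_compact hT) oV1)
           (open_hyperspace_meets (cX := tds_compact hT) oV2)) KU0 KV0.
  apply: sub_infinite_set => n [C /=[]]; rewrite !hset_iter_hyperspace_map.
  move=> [[_ [[x Cx <-] V1x]] [_ [[y Cy <-] V2y]]] CU.
  by split; [exists x|exists y]; split => //; exact: CU.
move=> U V oU oV [[u1 u2] Uu] [[v1 v2] Vv].
have box (W : set (X * X)) w1 w2 : open W -> W (w1, w2) ->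
    exists A B : set X, [/\ open A, open B, A w1, B w2 & A `*` B `<=` W].
  rewrite openE => oW /oW[[A B] /= [Aw Bw] ABW].
  exists A°, B°; split; [exact: open_interior|exact: open_interior| | |].
  - exact: nbhs_singleton (nbhs_interior Aw).
  - exact: nbhs_singleton (nbhs_interior Bw).
  - by move=> [a b] /= [/interior_subset ? /interior_subset ?]; apply: ABW.
have [U1 [U2 [oU1 oU2 U1u U2u UU]]] := box U u1 u2 oU Uu.
have [V1 [V2 [oV1 oV2 V1v V2v VV]]] := box V v1 v2 oV Vv.
have iter_surj n (x : X) : exists y, iter n T y = x.
  elim: n x => [|n IH] x; first by exists x.
  have [y _ <-] := tds_surjective hT (Logic.I : [set: X]%classic x).
  by have [z <-] := IH y; exists z.
have cT := tds_continuous hT.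
have /infinite_setN0[a [[e [U2e U1e]] _]] := ret U1 U2 U2 oU1 oU2 oU2
  (ex_intro _ u1 U1u) (ex_intro _ u2 U2u) (ex_intro _ u2 U2u).
(* Surjectivity makes the preimage of [V2] under the [a]-th iterate non-empty. *)
have [z az] := iter_surj a v2.
have := ret (U1 `&` iter a T @^-1` U2) V1 (iter a T @^-1` V2)
  (openI oU1 (open_iter_preimage cT a oU2)) oV1 (open_iter_preimage cT a oV2).
have V2z : (iter a T @^-1` V2) z by rewrite /= az.
move=> /(_ (ex_intro _ e (conj U1e U2e)) (ex_intro _ v1 V1v) (ex_intro _ z V2z)).
apply: sub_infinite_set => n [[x [/= V1x [U1x U2x]]] [y [/= V2y [U1y U2y]]]].
exists (x, iter a T y); split; last exact: UU.
by rewrite /= iter_pair; apply: VV; split => //=; rewrite -iterD addnC iterD.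
Qed.

Lemma E_system_hyperspace_map :
  weakly_mixing T -> E_system T -> E_system TK.
Proof.
move=> wT [_ tT [x0 [mu [Tmu supp]]]].
have [C0 _] := finite_hyperspace hT (finite_set1 x0) (ex_intro _ x0 erefl).
split; first exact: hyperspace_map_tds.
  exact: transitive_hyperspace_map.
exists C0; apply: exists_invariant_probability_full_support.
- exact: compact_hyperspace.
- exact: hyperspace_map_continuous.
move=> U oU U0; have [s [e [e0 [y0 y0s]] sU]] := hyperspace_box oU U0.
(* Induction on the centres, starting from all times: each new centre thins out the set of common
   visit times without making its density zero. *)
have visits (l : seq X) : exists g : X -> X, ~ null_density (R := R)
    [set n | forall x, x \in l -> ball x e (iter n T (g x))].
  elim: l => [|a l [g gl]].
    exists id; have := @not_null_densityT R; apply: contra_not.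
    exact: null_densityS.
  have a0 : (0 < mu (ball a e)°)%E.
    have : measure_support mu a by rewrite supp.
    apply; split; first exact: open_interior.
    exact: nbhs_singleton (nbhs_interior (nbhsx_ballx _ _ e0)).
  have [y yl] := exists_visits (tds_continuous hT) Tmu (@open_interior _ (ball a e)) a0 gl.
  (* If [a] already occurs in [l], its old point is replaced by [y], which visits the same ball at
     the retained times. *)
  exists (fun x => if x == a then y else g x).
  apply: contra_not yl; apply: null_densityS => n [ln /interior_subset an] x.
  by rewrite inE; case: eqVneq => [->|_ /= /ln].
have [g gs] := visits s.
have [|C CE] := finite_hyperspace hT (finite_image g (finite_seq s)).
  by exists (g y0), y0.
exists C; apply: contra_not gs; apply: null_densityS => n ln /=; apply: sU.
rewrite hset_iter_hyperspace_map CE image_comp.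
apply: (finite_image_in_box (c := id)) => [x xs|x xs]; last by exists x.
by split => //; exact: ln.
Qed.

Lemma E_system_of_hyperspace : E_system TK -> weakly_mixing T /\ E_system T.
Proof.
move=> [_ tK [C0 [nu [Tnu supp]]]].
have wT := weakly_mixing_of_hyperspace tK.
have [x0 _] := hset_neq0 C0.
split => //; split => //.
  exact: weakly_mixing_transitive.
exists x0; apply: exists_invariant_probability_full_support.
- exact: tds_compact hT.
- exact: tds_continuous hT.
move=> U oU [u Uu].
have oKU := open_hyperspace_sub (cX := tds_compact hT) oU.
(* This open set contains the singleton of [u], a point of the support of [nu]. *)
have KU0 : (0 < nu [set C | hset C `<=` U])%E.
  have [|C CE] := finite_hyperspace hT (finite_set1 u); first by exists u.
  have : measure_support nu C by rewrite supp.
  by apply; split => //=; rewrite CE => _ ->.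
have [C CU] := exists_visits (@hyperspace_map_continuous _ _ _ hT) Tnu oKU KU0
  (@not_null_densityT R).
have [x Cx] := hset_neq0 C; exists x.
apply: contra_not CU; apply: null_densityS => n [_] /=.
by rewrite hset_iter_hyperspace_map => CU; apply: CU; exists x.
Qed.

End hyperspace_dynamics.

Theorem theorem3p6 (R : realType) (X : metricType R) (T : X -> X)
    (hT : tds T) :
  (weakly_mixing T /\ E_system T) <-> E_system (hyperspace_map hT).
Proof.
split; last exact: E_system_of_hyperspace.
by move=> [wT eT]; exact: E_system_hyperspace_map.
Qed.
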